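(* Let $G=\{g_t\}_{t\in\mathbb R}$ be a one-parameter continuous subgroup of the affine group $\mathcal G$, and let $G\ni g_t\mapsto U_t$ be a strongly continuous unitary representation of $G$ in a Hilbert space $\mathcal H$. Assume that $A$ is a maximal dissipative operator in $\mathcal H$ which is $G$-invariant with respect to this representation. Then the strongly continuous unitary group $U_t$ and the strongly continuous semigroup of contractions $V_s=e^{iAs}$, $s\ge 0$, generated by $A$ satisfy the restricted generalized Weyl commutation relations $$U_tV_s=e^{isg_t(0)}V_{g_t'(0)s}U_t,\qquad t\in\mathbb R,\ s\ge 0,$$ where $g_t'(0)=\frac{d}{dx}g_t(x)\big|_{x=0}$. Conversely, if a strongly continuous unitary group $U_t$ (with $g_t\mapsto U_t$ a representation of $G$) and a strongly continuous semigroup of contractions $V_s=e^{iAs}$, $s\ge0$, satisfy these relations, then the generator $A$ of the semigroup $V_s$ is $G$-invariant with respect to the group $G=\{g_t\}_{t\in\mathbb R}$ and its unitary representation $g_t\mapsto U_t$.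
   Context: $\mathcal G$ denotes the group (under composition) of affine maps $g(x)=ax+b$ of $\mathbb R$ with $a>0$, $b\in\mathbb R$. For an operator $A$ and $g(x)=ax+b$, $g(A)$ denotes $aA+bI$. Given a subgroup $G\subset\mathcal G$ and a unitary representation $G\ni g\mapsto U_g$ ($U_fU_g=U_{fg}$) on a separable Hilbert space, a densely defined closed operator $A$ is called $G$-invariant (with respect to this representation) if for all $g\in G$ one has $U_g(\mathrm{Dom}(A))=\mathrm{Dom}(A)$ and $U_gAU_g^*f=aAf+bf$ for all $f\in\mathrm{Dom}(A)$, where $g(x)=ax+b$. An operator $A$ is dissipative if $\operatorname{Im}(Af,f)\ge0$ for $f\in\mathrm{Dom}(A)$, and maximal dissipative if it has no proper dissipative extension. *)

(* Defs.v *)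
From HB Require Import structures.
From mathcomp Require Import all_boot all_order all_algebra.
From mathcomp Require Import complex.
From mathcomp Require Import reals trigo.

Set Implicit Arguments.
Unset Strict Implicit.
Unset Printing Implicit Defensive.
Import Order.TTheory GRing.Theory Num.Theory.
Local Open Scope ring_scope.
Local Open Scope complex_scope.

HB.mixin Record Lmodule_isPreHilbert (R : rcfType) H of GRing.Lmodule (R[i]) H :=
  { inner : H -> H -> R[i];
    inner_linear : forall (c : R[i]) (x y z : H),
        inner (c *: x + y) z = c * inner x z + inner y z;
    inner_conj : forall x y : H, inner x y = conjc (inner y x);
    inner_ge0 : forall x : H, 0 <= inner x x;
    inner_eq0 : forall x : H, inner x x = 0 -> x = 0 }.

#[short(type="preHilbertType")]
HB.structure Definition PreHilbert (R : rcfType) :=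
  { H of Lmodule_isPreHilbert R H & GRing.Lmodule (R[i]) H }.

Definition hnorm (R : rcfType) (H : preHilbertType R) (f : H) : R :=
  Num.sqrt (complex.Re (inner f f)).

HB.mixin Record PreHilbert_isHilbert (R : rcfType) H of PreHilbert R H :=
  { hilbert_complete : forall u : nat -> H,
      (forall e : R, 0 < e -> exists N : nat, forall m n : nat,
          (N <= m)%N -> (N <= n)%N -> hnorm (u m - u n) < e) ->
      exists l : H, forall e : R, 0 < e -> exists N : nat, forall n : nat,
          (N <= n)%N -> hnorm (u n - l) < e;
    hilbert_separable : exists d : nat -> H,
      forall (f : H) (e : R), 0 < e -> exists n : nat, hnorm (f - d n) < e }.

#[short(type="hilbertType")]
HB.structure Definition Hilbert (R : rcfType) :=
  { H of PreHilbert_isHilbert R H & PreHilbert R H }.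

Section Operators.
Variables (R : realType) (H : hilbertType R).

(* The values of [op_app] outside [op_dom] are irrelevant.              *)
Record op := Op { op_dom : H -> Prop; op_app : H -> H }.

Definition linear_op (A : op) : Prop :=
  op_dom A 0 /\
  forall (c : R[i]) (f g : H), op_dom A f -> op_dom A g ->
    op_dom A (c *: f + g) /\
    op_app A (c *: f + g) = c *: op_app A f + op_app A g.

Definition densely_defined (A : op) : Prop :=
  forall (f : H) (e : R), 0 < e -> exists g : H, op_dom A g /\ hnorm (f - g) < e.

Definition seq_cvg (u : nat -> H) (l : H) : Prop :=
  forall e : R, 0 < e -> exists N : nat, forall n : nat,
    (N <= n)%N -> hnorm (u n - l) < e.

Definition closed_op (A : op) : Prop :=
  forall (u : nat -> H) (f g : H), (forall n, op_dom A (u n)) ->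
    seq_cvg u f -> seq_cvg (fun n => op_app A (u n)) g ->
    op_dom A f /\ op_app A f = g.

Definition dissipative (A : op) : Prop :=
  forall f : H, op_dom A f -> 0 <= complex.Im (inner (op_app A f) f).

Definition extends (B A : op) : Prop :=
  forall f : H, op_dom A f -> op_dom B f /\ op_app B f = op_app A f.

Definition max_dissipative (A : op) : Prop :=
  linear_op A /\ dissipative A /\
  forall B : op, linear_op B -> dissipative B -> extends B A ->
    forall f : H, op_dom B f -> op_dom A f.

Definition linear_map (T : H -> H) : Prop :=
  forall (c : R[i]) (f g : H), T (c *: f + g) = c *: T f + T g.

Definition unitary (T : H -> H) : Prop :=
  linear_map T /\ (forall f g : H, inner (T f) (T g) = inner f g) /\
  (forall g : H, exists f : H, T f = g).

Definition is_adjoint (T S : H -> H) : Prop :=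
  forall f g : H, inner (T f) g = inner f (S g).

(* One-parameter continuous subgroups g_t(x) = a t * x + b t of the      *)
(* affine group: a t > 0, t |-> g_t continuous group homomorphism        *)
(* (R,+) -> (G, o), i.e. g_(t+s) = g_t o g_s.                            *)
Definition real_continuous (h : R -> R) : Prop :=
  forall (t0 e : R), 0 < e -> exists d : R, 0 < d /\
    forall t : R, `|t - t0| < d -> `|h t - h t0| < e.

Definition one_param_affine_subgroup (a b : R -> R) : Prop :=
  (forall t, 0 < a t) /\
  (forall t s, a (t + s) = a t * a s) /\
  (forall t s, b (t + s) = a t * b s + b t) /\
  real_continuous a /\ real_continuous b.

(* t |-> U t is a strongly continuous unitary representation of
   G = {g_t}, i.e. U t = U_{g_t} for a unitary representation g |-> U_g of G
   (well defined on G, multiplicative) which is strongly continuous in t. *)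
Definition strongly_continuous_unitary_rep (a b : R -> R) (U : R -> H -> H) : Prop :=
  (forall t, unitary (U t)) /\
  (forall t s, a t = a s -> b t = b s -> U t = U s) /\
  (forall t s (f : H), U t (U s f) = U (t + s) f) /\
  (forall (f : H) (t0 e : R), 0 < e -> exists d : R, 0 < d /\
    forall t : R, `|t - t0| < d -> hnorm (U t f - U t0 f) < e).

Definition G_invariant (a b : R -> R) (U : R -> H -> H) (A : op) : Prop :=
  linear_op A /\ densely_defined A /\ closed_op A /\
  forall t : R,
    (forall f, op_dom A f -> op_dom A (U t f)) /\
    (forall f, op_dom A f -> exists h, op_dom A h /\ U t h = f) /\
    (forall Ustar : H -> H, is_adjoint (U t) Ustar ->
      forall f, op_dom A f ->
        U t (op_app A (Ustar f)) = (a t)%:C *: op_app A f + (b t)%:C *: f).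

Definition contraction_semigroup (V : R -> H -> H) : Prop :=
  (forall s, 0 <= s -> linear_map (V s)) /\
  (forall f : H, V 0 f = f) /\
  (forall s r (f : H), 0 <= s -> 0 <= r -> V s (V r f) = V (s + r) f) /\
  (forall s (f : H), 0 <= s -> hnorm (V s f) <= hnorm f) /\
  (forall (f : H) (s0 e : R), 0 <= s0 -> 0 < e -> exists d : R, 0 < d /\
    forall s : R, 0 <= s -> `|s - s0| < d -> hnorm (V s f - V s0 f) < e).

Definition right_deriv0 (V : R -> H -> H) (f g : H) : Prop :=
  forall e : R, 0 < e -> exists d : R, 0 < d /\
    forall s : R, 0 < s -> s < d ->
      hnorm ((s^-1)%:C *: (V s f - f) - g) < e.

(* V s = e^{iAs}: the generator of V is iA, i.e. Dom A is the set of f for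
   which the right derivative at 0 of s |-> V s f exists, and it is i A f. *)
Definition generated_by (A : op) (V : R -> H -> H) : Prop :=
  forall f : H, (op_dom A f <-> exists g, right_deriv0 V f g) /\
    (op_dom A f -> right_deriv0 V f ('i *: op_app A f)).

(* restricted generalized Weyl relations
   U_t V_s = e^{i s g_t(0)} V_{g_t'(0) s} U_t, t real, s >= 0,
   where g_t(0) = b t and g_t'(0) = a t. *)
Definition cexpi (x : R) : R[i] := Complex (cos x) (sin x).

Definition weyl_relations (a b : R -> R) (U V : R -> H -> H) : Prop :=
  forall (t s : R) (f : H), 0 <= s ->
    U t (V s f) = cexpi (s * b t) *: V (a t * s) (U t f).

End Operators.

(* Main.v *)
Require Import Defs.
From HB Require Import structures.
From mathcomp Require Import all_boot all_order all_algebra.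
From mathcomp Require Import complex.
From mathcomp Require Import reals trigo.
From mathcomp Require Import boolp normedtype derive realfun lra ring.

Set Implicit Arguments.
Unset Strict Implicit.
Unset Printing Implicit Defensive.
Import Order.TTheory GRing.Theory Num.Theory numFieldNormedType.Exports.
Local Open Scope ring_scope.
Local Open Scope complex_scope.

(** Both directions rest on one elementary fact: a left-continuous curve [u]
    with [u 0 = 0] and [|u (s + h)| <= |u s| + C h + o(h)] satisfies
    [|u s| <= C s].

    Weyl relations from invariance: for fixed [t], [U_t V_s U_t^*] and
    [e^{i s b_t} V_{a_t s}] are two semigroups of contractions having the same
    derivative [i (a_t A + b_t)] at [0] on [Dom A], which is dense and invariant
    under the second one; hence they coincide.

    Invariance from the Weyl relations: differentiating
    [V_h U_t f = e^{- i h b_t / a_t} U_t V_{h / a_t} f] at [h = 0] shows that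
    [U_t f] lies in [Dom A] and computes [A U_t f].  That the generator of a
    contraction semigroup is closed follows from the Taylor estimate
    [|V_s f - f - s g| <= s sup_{r < s} |V_r g - g|]; that it is densely defined
    follows by averaging orbits, the integral of [s |-> V_s f] being obtained as
    a limit of polygonal primitives. *)

(** * Inner product and norm: Cauchy-Schwarz and the triangle inequality *)

Section Norm.
Variables (R : realType) (H : preHilbertType R).
Implicit Types (x y z : H) (r : R) (c : R[i]).

Lemma innerD x y z : inner (x + y) z = inner x z + inner y z.
Proof. by rewrite -[x in LHS]scale1r inner_linear mul1r. Qed.

Lemma inner0l z : inner (0 : H) z = 0.
Proof. by apply: (addIr (inner 0 z)); rewrite -innerD !add0r. Qed.

Lemma innerZl c x z : inner (c *: x) z = c * inner x z.
Proof. by rewrite -[c *: x]addr0 inner_linear inner0l addr0. Qed.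

Lemma innerN x z : inner (- x) z = - inner x z.
Proof. by rewrite -scaleN1r innerZl mulN1r. Qed.

Lemma inner_inj x y : (forall z, inner x z = inner y z) -> x = y.
Proof.
move=> xy; apply/eqP; rewrite -subr_eq0; apply/eqP/inner_eq0.
by rewrite innerD innerN xy subrr.
Qed.

Lemma Re_inner_ge0 x : 0 <= complex.Re (inner x x).
Proof. by have := inner_ge0 x; rewrite lecE => /andP[]. Qed.

Lemma Im_inner x : complex.Im (inner x x) = 0.
Proof. exact/ger0_Im/inner_ge0. Qed.

Lemma hnorm_ge0 x : 0 <= hnorm x.
Proof. exact: sqrtr_ge0. Qed.

Lemma sqr_hnorm x : hnorm x ^+ 2 = complex.Re (inner x x).
Proof. exact/sqr_sqrtr/Re_inner_ge0. Qed.

Lemma hnorm0 : hnorm (0 : H) = 0.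
Proof. by rewrite /hnorm inner0l sqrtr0. Qed.

Lemma hnorm0_eq0 x : hnorm x = 0 -> x = 0.
Proof.
move=> x0; apply: inner_eq0; apply/eqP; rewrite eq_complex Im_inner eqxx andbT.
by rewrite -sqr_hnorm x0 expr0n.
Qed.

Lemma hnormZ c x : hnorm (c *: x) = ComplexField.Normc.normc c * hnorm x.
Proof.
apply/eqP; rewrite -(@eqrXn2 _ 2) ?mulr_ge0 ?hnorm_ge0 //; last first.
  by case: c => u v; exact: sqrtr_ge0.
rewrite exprMn !sqr_hnorm innerZl inner_conj innerZl.
have := Im_inner x; case: (inner x x) => p q /= ->; case: c => u v /=.
rewrite sqr_sqrtr ?addr_ge0 ?sqr_ge0 //.
by apply/eqP; ring.
Qed.

Lemma hnormZr r x : 0 <= r -> hnorm (r%:C *: x) = r * hnorm x.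
Proof. by move=> r0; rewrite hnormZ /= expr0n addr0 sqrtr_sqr ger0_norm. Qed.

Lemma hnorm_cexpi r x : hnorm (cexpi r *: x) = hnorm x.
Proof. by rewrite hnormZ /= cos2Dsin2 sqrtr1 mul1r. Qed.

Lemma hnorm_i x : hnorm ('i *: x) = hnorm x.
Proof. by rewrite -complexiE hnormZ /= expr0n expr1n add0r sqrtr1 mul1r. Qed.

Lemma hnormN x : hnorm (- x) = hnorm x.
Proof.
by rewrite -scaleN1r hnormZ /= oppr0 sqrrN expr0n addr0 expr1n sqrtr1 mul1r.
Qed.

Lemma hnormC x y : hnorm (x - y) = hnorm (y - x).
Proof. by rewrite -opprB hnormN. Qed.

(** A real coefficient on one side suffices: a negative [r] gives Cauchy-Schwarz, and [r = 1] the
    triangle inequality. *)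
Lemma sqr_hnormD r x y : hnorm (r%:C *: x + y) ^+ 2 =
  r ^+ 2 * hnorm x ^+ 2 + 2 * r * complex.Re (inner x y) + hnorm y ^+ 2.
Proof.
rewrite !sqr_hnorm innerD innerZl (inner_conj x (_ + _)) (inner_conj y (_ + _)).
rewrite !innerD !innerZl (inner_conj y x).
have := Im_inner x; have := Im_inner y.
case: (inner x x) => p q; case: (inner y y) => p' q' /= -> ->.
by case: (inner x y) => u v /=; ring.
Qed.

Lemma Re_inner_le x y : complex.Re (inner x y) <= hnorm x * hnorm y.
Proof.
have [x0|x0] := eqVneq (hnorm x) 0.
  by rewrite (hnorm0_eq0 x0) inner0l hnorm0 mul0r.
have {}x0 : 0 < hnorm x by rewrite lt_def x0 hnorm_ge0.
(* With the coefficient [hnorm y / hnorm x] the expanded square factors as a nonnegative number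
   times the difference to be bounded. *)
have := sqr_ge0 (hnorm ((- (hnorm y / hnorm x))%:C *: x + y)).
rewrite sqr_hnormD; set u := hnorm x in x0 *; set v := hnorm y.
set w := complex.Re _.
have -> : (- (v / u)) ^+ 2 * u ^+ 2 + 2 * - (v / u) * w + v ^+ 2 =
  2 * (v / u) * (u * v - w) by field; exact: lt0r_neq0.
have [v0|v0] := eqVneq v 0; last first.
  by rewrite pmulr_rge0 ?subr_ge0 // !mulr_gt0 ?invr_gt0 // lt_def v0 hnorm_ge0.
by move=> _; rewrite /w inner_conj (hnorm0_eq0 v0) inner0l v0 mulr0.
Qed.

Lemma hnormD x y : hnorm (x + y) <= hnorm x + hnorm y.
Proof.
rewrite -(@ler_pXn2r _ 2) ?nnegrE ?addr_ge0 ?hnorm_ge0 //.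
rewrite -[x in leLHS]scale1r -(_ : 1%:C = 1) // sqr_hnormD.
have := Re_inner_le x y; nra.
Qed.

Lemma hnormB x y : hnorm (x - y) <= hnorm x + hnorm y.
Proof. by rewrite -(hnormN y) hnormD. Qed.

Lemma hnorm_dist y x z : hnorm (x - z) <= hnorm (x - y) + hnorm (y - z).
Proof. by rewrite -{1}(subrK y x) -addrA hnormD. Qed.

Lemma scaleRC r c x : r%:C *: (c *: x) = c *: (r%:C *: x).
Proof. by rewrite !scalerA mulrC. Qed.

Lemma scaleRM (r s : R) x : (r * s)%:C *: x = r%:C *: (s%:C *: x).
Proof. by rewrite scalerA rmorphM. Qed.

Lemma hnorm_small_eq0 x : (forall e : R, 0 < e -> hnorm x <= e) -> x = 0.
Proof.
move=> small; apply: hnorm0_eq0; apply/eqP; rewrite eq_le hnorm_ge0 andbT.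
by apply/ler_addgt0Pl => e e0; rewrite addr0 small.
Qed.

End Norm.

(* Pairing with an arbitrary vector reduces an identity between vectors to one
   between scalars. *)
Ltac vector_ring :=
  apply: inner_inj => ?; rewrite ?(innerD, innerN, innerZl, inner0l); ring.

(** Continuous induction: let [c] be the supremum of the times up to which the bound with slope
    [C + e] holds. The left condition carries the bound to [c] itself, and the right condition
    carries it beyond [c] unless [c = s]. *)
Lemma growth_le (R : realType) (phi : R -> R) (C T : R) : 0 <= C ->
  phi 0 <= 0 ->
  (forall s, 0 <= s -> s < T -> forall e, 0 < e -> exists2 d, 0 < d &
     forall h, 0 < h -> h < d -> phi (s + h) <= phi s + (C + e) * h) ->
  (forall s, 0 < s -> s <= T -> forall e, 0 < e -> exists2 d, 0 < d &
     forall h, 0 < h -> h < d -> h <= s -> phi s <= phi (s - h) + e) ->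
  forall s, 0 <= s -> s <= T -> phi s <= C * s.
Proof.
move=> C0 phi0 rphi lphi s s0 sT; apply/ler_addgt0Pl => e' e'0.
(* This choice keeps the accumulated excess [e * s] below [e']. *)
pose e := e' / (s + 1).
have e0 : 0 < e by rewrite divr_gt0 // ltr_wpDl.
apply: (@le_trans _ _ ((C + e) * s)); last first.
  rewrite mulrDl addrC lerD2r /e mulrAC ler_pdivrMr ?ltr_wpDl //; nra.
(* Requiring the bound at all earlier times makes [E] an interval, so that everything before its
   supremum is covered. *)
pose good t := forall r, 0 <= r -> r <= t -> phi r <= (C + e) * r.
suff : good s by apply.
pose E : classical_sets.set R := fun t => [/\ 0 <= t, t <= s & good t].
have E0 : E 0.
  by split=> // r r0 r0'; have -> : r = 0; [lra|rewrite mulr0].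
have Eub : classical_sets.has_ubound E by exists s => t [].
have Ene : classical_sets.nonempty E by exists 0.
set c := sup E.
have c0 : 0 <= c by exact: ub_le_sup.
have cs : c <= s by apply: ge_sup => // t [].
have good_lt r : 0 <= r -> r < c -> phi r <= (C + e) * r.
  by move=> r0 /(sup_gt Ene)[t [_ _ tg] rt]; apply: tg => //; exact: ltW.
have phic : phi c <= (C + e) * c.
  have [->|cn0] := eqVneq c 0; first by rewrite mulr0.
  have {}cn0 : 0 < c by rewrite lt_def cn0.
  apply/ler_addgt0Pl => e1 e10.
  have [d d0 dP] := lphi c cn0 (le_trans cs sT) e1 e10.
  have md : 0 < Num.min d c by rewrite lt_min d0.
  have [mld mlc] : Num.min d c <= d /\ Num.min d c <= c.
    by rewrite !ge_min !lexx orbT.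
  pose h := Num.min d c / 2.
  have h0 : 0 < h by rewrite /h; lra.
  have := dP h h0; have := good_lt (c - h).
  rewrite /h in h0 *; move=> /(_ ltac:(lra) ltac:(lra)) ? /(_ ltac:(lra) ltac:(lra)).
  nra.
have goodc : good c.
  move=> r r0; rewrite le_eqVlt => /orP[/eqP -> //|]; exact: good_lt.
have [<- //|cns] := eqVneq c s.
have {}cns : c < s by rewrite lt_def eq_sym cns.
have [d d0 dP] := rphi c c0 (lt_le_trans cns sT) e e0.
have md : 0 < Num.min d (s - c) by rewrite lt_min d0 subr_gt0.
have [mld mlc] : Num.min d (s - c) <= d /\ Num.min d (s - c) <= s - c.
  by rewrite !ge_min !lexx orbT.
(* A point of [E] strictly to the right of [c], contradicting the choice of [c] as supremum. *)
pose t := c + Num.min d (s - c) / 2.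
suff /(ub_le_sup Eub) : E t by rewrite -/c /t; lra.
split; [by rewrite /t; lra|by rewrite /t; lra|move=> r r0 rt].
have [rc|cr] := leP r c; first exact: goodc.
have := dP (r - c); rewrite [c + _]addrC subrK => /(_ ltac:(lra)).
rewrite /t in rt; move=> /(_ ltac:(lra)); nra.
Qed.

(** Restates a derivative at 0 as a first-order expansion with explicit remainder, the form used for
    tangents. *)
Lemma is_derive0_le (R : realType) (f : R -> R) (l e : R) :
  is_derive (0 : R) 1 f l -> 0 < e ->
  exists2 d, 0 < d & forall h, 0 < h -> h < d -> `|f h - f 0 - h * l| <= e * h.
Proof.
move=> [df <-] e0.
have /cvgrPdist_le/(_ e e0) := df.
move=> /nbhs_normP[d /= d0 dP].
exists d => // h h0 hd.
have := dP h; rewrite /= add0r normrN gtr0_norm // => /(_ hd) /(_ (lt0r_neq0 h0)).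
rewrite /derive; set l' := filter.lim _; rewrite addr0.
rewrite -[_ *: _]/(h^-1 * (f (h * 1) - f 0)) mulr1 => le.
rewrite -(ler_pM2l h0) in le; rewrite [leRHS]mulrC; apply: le_trans le.
have -> : f h - f 0 - h * l' = - (h * (l' - h^-1 * (f h - f 0))).
  by field; exact: lt0r_neq0.
by rewrite normrN normrM gtr0_norm.
Qed.

Section LinearMap.
Variables (R : realType) (H : hilbertType R) (T : H -> H).
Hypothesis lT : linear_map T.

Lemma linear_mapD f g : T (f + g) = T f + T g.
Proof. by rewrite -[f in LHS]scale1r lT scale1r. Qed.

Lemma linear_map0 : T 0 = 0.
Proof. by apply: (addIr (T 0)); rewrite -linear_mapD !add0r. Qed.

Lemma linear_mapZ c f : T (c *: f) = c *: T f.
Proof. by rewrite -[c *: f]addr0 lT linear_map0 addr0. Qed.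

Lemma linear_mapB f g : T (f - g) = T f - T g.
Proof. by rewrite linear_mapD -scaleN1r linear_mapZ scaleN1r. Qed.

End LinearMap.

(** * Calculus of right derivatives at 0 *)

Section Tangent.
Variables (R : realType) (H : hilbertType R).
Implicit Types (u v : R -> H) (f g x : H).

(** The expansion [u h = h g + o(h)] as [h] decreases to 0. Being free of division, it passes
    through sums and contractions directly. *)
Definition tangent u g := forall e : R, 0 < e -> exists2 d, 0 < d &
  forall h, 0 < h -> h < d -> hnorm (u h - h%:C *: g) <= e * h.

Lemma right_deriv0P (V : R -> H -> H) f g :
  right_deriv0 V f g <-> tangent (fun h => V h f - f) g.
Proof.
have E h : 0 < h -> h * hnorm (h^-1%:C *: (V h f - f) - g) =
    hnorm (V h f - f - h%:C *: g).
  move=> h0; rewrite -hnormZr ?ltW // scalerBr -scaleRM divff ?lt0r_neq0 //.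
  by rewrite scale1r.
split=> D e e0.
  have [d [d0 dP]] := D e e0; exists d => // h h0 hd.
  by rewrite -E // mulrC ler_pM2r // ltW // dP.
(* Halving [e] turns the non-strict bound of [tangent] into a strict one. *)
have [d d0 dP] := D (e / 2) (divr_gt0 e0 (ltr0n _ 2)).
exists d; split=> // h h0 hd; rewrite -(ltr_pM2l h0) E //.
by apply: (le_lt_trans (dP h h0 hd)); nra.
Qed.

Lemma tangent_ext_near u v g r : 0 < r ->
  (forall h, 0 < h -> h < r -> u h = v h) -> tangent u g -> tangent v g.
Proof.
move=> r0 uv D e /D[d d0 dP]; exists (Num.min d r); first by rewrite lt_min d0.
by move=> h h0; rewrite lt_min => /andP[hd hr]; rewrite -uv // dP.
Qed.

Lemma tangent_ext u v g : (forall h, 0 < h -> u h = v h) ->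
  tangent u g -> tangent v g.
Proof. by move=> uv; apply: tangent_ext_near ltr01 _ => h h0 _; exact: uv. Qed.

Lemma tangentD u v f g : tangent u f -> tangent v g ->
  tangent (fun h => u h + v h) (f + g).
Proof.
move=> Du Dv e e0; have e20 : 0 < e / 2 by lra.
have [d d0 dP] := Du _ e20; have [d' d'0 d'P] := Dv _ e20.
exists (Num.min d d'); first by rewrite lt_min d0.
move=> h h0; rewrite lt_min => /andP[hd hd'].
rewrite scalerDr opprD addrACA; apply: (le_trans (hnormD _ _)).
have := dP h h0 hd; have := d'P h h0 hd'; lra.
Qed.

Lemma tangentZ c u g : tangent u g -> tangent (fun h => c *: u h) (c *: g).
Proof.
move=> D e e0; set n := ComplexField.Normc.normc c.
have n0 : 0 <= n by rewrite /n; case: (c) => x y; exact: sqrtr_ge0.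
have [|d d0 dP] := D (e / (n + 1)); first by rewrite divr_gt0 // ltr_wpDl.
exists d => // h h0 hd; rewrite scaleRC -scalerBr hnormZ -/n.
apply: (@le_trans _ _ ((n + 1) * (e / (n + 1) * h))); last first.
  by rewrite mulrA mulrCA divff ?mulr1 // lt0r_neq0 // ltr_wpDl.
by apply: ler_pM; rewrite ?hnorm_ge0 ?lerDl ?dP.
Qed.

Lemma tangentB u v f g : tangent u f -> tangent v g ->
  tangent (fun h => u h - v h) (f - g).
Proof.
move=> Du Dv; rewrite -scaleN1r; apply: tangent_ext (tangentD Du (tangentZ _ Dv)).
by move=> h _ /=; rewrite scaleN1r.
Qed.

Lemma tangent_time k u g : 0 < k -> tangent u g ->
  tangent (fun h => u (k * h)) (k%:C *: g).
Proof.
move=> k0 D e e0; have [|d d0 dP] := D (e / k); first exact: divr_gt0.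
exists (d / k); first exact: divr_gt0.
move=> h h0; rewrite ltr_pdivlMr // mulrC => hd.
rewrite -scaleRM [h * k]mulrC; apply: (le_trans (dP _ _ hd)); first exact: mulr_gt0.
by rewrite mulrA divfK // lt0r_neq0.
Qed.

Lemma tangent_map (T : H -> H) u g : linear_map T ->
  (forall x, hnorm (T x) <= hnorm x) ->
  tangent u g -> tangent (fun h => T (u h)) (T g).
Proof.
move=> lT cT D e /D[d d0 dP]; exists d => // h h0 hd.
by rewrite -(linear_mapZ lT) -(linear_mapB lT) (le_trans (cT _)) ?dP.
Qed.

Lemma tangent_uniq u f g : tangent u f -> tangent u g -> f = g.
Proof.
move=> Df Dg; apply/eqP; rewrite -subr_eq0; apply/eqP.
apply: hnorm_small_eq0 => e e0.
have [d d0 dP] := tangentB Df Dg e0.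
have d20 : 0 < d / 2 by lra.
have := dP (d / 2) d20 ltac:(lra); cbv beta.
by rewrite [u _ - u _]subrr sub0r hnormN (hnormZr _ (ltW d20)) [e * _]mulrC ler_pM2l.
Qed.

(** The coordinates of the scalar remainder are the first-order remainders of cosine and sine at 0.
    Each is at most [e1 * h], so the modulus is at most [2 * e1 * h]. *)
Lemma tangent_cexpi b x :
  tangent (fun h => cexpi (h * b) *: x - x) (b%:C *: ('i *: x)).
Proof.
move=> e e0; pose k := hnorm x + 1.
have k0 : 0 < k by rewrite ltr_wpDl ?hnorm_ge0.
pose e1 := e / (2 * k).
have e10 : 0 < e1 by rewrite divr_gt0 // mulr_gt0.
have Db : is_derive (0 : R) 1 (fun h => b * h) b.
  by apply: is_derive_eq (is_deriveZ b (is_derive_id _ _)) _; exact: mulr1.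
have Dc := is_derive1_comp (is_derive_cos (b * 0)) Db.
have Ds := is_derive1_comp (is_derive_sin (b * 0)) Db.
have [d d0 dP] := is_derive0_le Dc e10.
have [d' d'0 d'P] := is_derive0_le Ds e10.
exists (Num.min d d'); first by rewrite lt_min d0.
move=> h h0; rewrite lt_min => /andP[hd hd'].
have := dP h h0 hd; have := d'P h h0 hd'.
rewrite /= !mulr0 sin0 cos0 oppr0 mul0r mulr0 !subr0 mul1r ![b * h]mulrC.
set s := sin _; set c := cos _ => hs hc.
have -> : cexpi (h * b) *: x - x - h%:C *: (b%:C *: ('i *: x)) =
    (Complex (c - 1) (s - h * b)) *: x.
  rewrite -{2}[x]scale1r !scalerA -!scalerBl -complexiE; congr (_ *: _).
  by apply/eqP; rewrite eq_complex /= /c /s; apply/andP; split; apply/eqP; ring.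
rewrite hnormZ.
have nle : ComplexField.Normc.normc (Complex (c - 1) (s - h * b)) <= 2 * e1 * h.
  have m0 : 0 <= 2 * e1 * h by rewrite ltW // mulr_gt0 // mulr_gt0.
  rewrite /= -[leRHS](ger0_norm m0) -sqrtr_sqr ler_wsqrtr //.
  have sq A : `|A| <= e1 * h -> A ^+ 2 <= (e1 * h) ^+ 2.
    by rewrite ler_norml => /andP[? ?]; nra.
  rewrite addr0 in hs; have := sq _ hs; have := sq _ hc.
  have := sqr_ge0 (e1 * h); rewrite -mulrA [X in _ <= X]exprMn; lra.
apply: (@le_trans _ _ (2 * e1 * h * k)).
  by apply: ler_pM; rewrite ?hnorm_ge0 ?sqrtr_ge0 ?lerDl.
by rewrite /e1 le_eqVlt; apply/orP; left; apply/eqP; field; exact: lt0r_neq0.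
Qed.

(** Product rule, by splitting off [cexpi (h * b) *: f - f]. In the other term the phase is
    isometric and moves [h%:C *: g] only by a multiple of [h ^+ 2]. *)
Lemma tangent_cexpiM b u f g : tangent (fun h => u h - f) g ->
  tangent (fun h => cexpi (h * b) *: u h - f) (g + b%:C *: ('i *: f)).
Proof.
move=> D; apply: (tangent_ext (u := fun h => cexpi (h * b) *: (u h - f) +
  (cexpi (h * b) *: f - f))).
  by move=> h _; rewrite scalerBr addrA subrK.
apply: tangentD (tangent_cexpi b f) => e e0; have e20 : 0 < e / 2 by lra.
have [d d0 dP] := D _ e20.
set y := b%:C *: ('i *: g).
have [d' d'0 d'P] := tangent_cexpi b g (ltr01 : 0 < 1 :> R).
(* Near 0 the phase moves [g] by at most [h * k]; below [d3] this is at most [e / 2]. *)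
pose k := 1 + hnorm y; have k0 : 0 < k by rewrite ltr_pwDl ?hnorm_ge0.
pose d3 := e / 2 / k; have d30 : 0 < d3 by rewrite divr_gt0.
exists (Num.min d (Num.min d' d3)); first by rewrite !lt_min d0 d'0.
move=> h h0; rewrite !lt_min => /and3P[hd hd' hd3].
have := hnorm_dist (cexpi (h * b) *: (h%:C *: g))
  (cexpi (h * b) *: (u h - f)) (h%:C *: g).
rewrite -scalerBr hnorm_cexpi -scaleRC -scalerBr (hnormZr _ (ltW h0)) => le.
apply: (le_trans le).
have hy : hnorm (cexpi (h * b) *: g - g) <= h * k.
  have := hnorm_dist (h%:C *: y) (cexpi (h * b) *: g - g) 0.
  rewrite !subr0 (hnormZr _ (ltW h0)); have := d'P h h0 hd'; rewrite -/y /k; lra.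
have hk : h * k <= e / 2 by rewrite -ler_pdivlMr // ltW.
have := dP h h0 hd; have := ler_pM2l h0 (hnorm (cexpi (h * b) *: g - g)) (e / 2).
rewrite (le_trans hy hk) => ? ?; nra.
Qed.
End Tangent.

(** * Left continuity and the growth estimate for vector-valued curves *)

Section Growth.
Variables (R : realType) (H : hilbertType R).
Implicit Types (u v : R -> H) (f g : H) (T : R).

(** The condition [h <= s] keeps [s - h] among the nonnegative times, where a semigroup is
    controlled. *)
Definition left_continuous u T := forall s, 0 < s -> s <= T ->
  forall e : R, 0 < e -> exists2 d, 0 < d &
    forall h, 0 < h -> h < d -> h <= s -> hnorm (u s - u (s - h)) <= e.

Lemma left_continuousD u v T : left_continuous u T -> left_continuous v T ->
  left_continuous (fun s => u s + v s) T.
Proof.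
move=> cu cv s s0 sT e e0; have e20 : 0 < e / 2 by lra.
have [d d0 dP] := cu s s0 sT _ e20; have [d' d'0 d'P] := cv s s0 sT _ e20.
exists (Num.min d d'); first by rewrite lt_min d0.
move=> h h0; rewrite lt_min => /andP[hd hd'] hs.
rewrite opprD addrACA; apply: (le_trans (hnormD _ _)).
have := dP h h0 hd hs; have := d'P h h0 hd' hs; lra.
Qed.

Lemma left_continuous_map (L : H -> H) u T : linear_map L ->
  (forall x, hnorm (L x) <= hnorm x) ->
  left_continuous u T -> left_continuous (fun s => L (u s)) T.
Proof.
move=> lL cL cu s s0 sT e /(cu s s0 sT)[d d0 dP]; exists d => // h h0 hd hs.
by rewrite -(linear_mapB lL) (le_trans (cL _)) ?dP.
Qed.

Lemma left_continuousN u T : left_continuous u T ->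
  left_continuous (fun s => - u s) T.
Proof.
apply: left_continuous_map => [c f g|x]; last by rewrite hnormN.
by rewrite opprD scalerN.
Qed.

Lemma left_continuous_lip u T C d : 0 < d -> 0 < C ->
  (forall s h, 0 < h -> h < d -> 0 <= s -> s + h <= T ->
     hnorm (u (s + h) - u s) <= C * h) -> left_continuous u T.
Proof.
move=> d0 C0 lip s s0 sT e e0.
exists (Num.min d (e / C)); first by rewrite lt_min d0 divr_gt0.
move=> h h0; rewrite lt_min => /andP[hd]; rewrite ltr_pdivlMr // => he hs.
have := lip (s - h) h h0 hd; rewrite subr_ge0 subrK => /(_ hs sT) le.
by apply: (le_trans le); rewrite mulrC ltW.
Qed.

Lemma left_continuous_cst g T : left_continuous (fun=> g) T.
Proof.
apply: (left_continuous_lip ltr01 ltr01) => s h h0 _ _ _.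
by rewrite subrr hnorm0 mul1r ltW.
Qed.

Lemma left_continuous_scale g T : left_continuous (fun s => s%:C *: g) T.
Proof.
apply: (left_continuous_lip (C := hnorm g + 1) ltr01) => [|s h h0 _ _ _].
  by rewrite ltr_wpDl ?hnorm_ge0.
have -> : (s + h)%:C *: g - s%:C *: g = h%:C *: g by vector_ring.
by rewrite (hnormZr _ (ltW h0)); have := hnorm_ge0 g; nra.
Qed.

(** The growth bound applied to the norm of a curve. With [C = 0] it makes the curve vanish, which
    is how identities between curves are obtained below. *)
Lemma hnorm_growth_le u C T : 0 <= C -> u 0 = 0 -> left_continuous u T ->
  (forall s, 0 <= s -> s < T -> forall e, 0 < e -> exists2 d, 0 < d &
     forall h, 0 < h -> h < d -> hnorm (u (s + h)) <= hnorm (u s) + (C + e) * h) ->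
  forall s, 0 <= s -> s <= T -> hnorm (u s) <= C * s.
Proof.
move=> C0 u0 lu ru; apply: growth_le => //; first by rewrite u0 hnorm0.
move=> s s0 sT e /(lu s s0 sT)[d d0 dP]; exists d => // h h0 hd hs.
have := hnormD (u (s - h)) (u s - u (s - h)).
by have := dP h h0 hd hs; rewrite subrKC; lra.
Qed.

End Growth.

(** * Contraction semigroups: Taylor estimate, closedness, primitives of orbits, density *)

Section Semigroup.
Variables (R : realType) (H : hilbertType R) (V : R -> H -> H).
Hypothesis sV : contraction_semigroup V.
Implicit Types (f g : H).

Lemma semigroup_linear s : 0 <= s -> linear_map (V s).
Proof. by case: sV => + _; exact. Qed.

Lemma semigroup0 f : V 0 f = f.
Proof. by case: sV => _ [+ _]; exact. Qed.

Lemma semigroupD s r f : 0 <= s -> 0 <= r -> V (s + r) f = V s (V r f).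
Proof. by move=> s0 r0; case: sV => _ [_ [+ _]] => /(_ s r f s0 r0). Qed.

Lemma semigroup_contr s f : 0 <= s -> hnorm (V s f) <= hnorm f.
Proof. by case: sV => _ [_ [_ [+ _]]]; exact. Qed.

(** Factoring out the contraction [V s] bounds every increment by the one at 0, so continuity is
    uniform along an orbit. *)
Lemma semigroup_incr s h f : 0 <= s -> 0 <= h ->
  hnorm (V (s + h) f - V s f) <= hnorm (V h f - f).
Proof.
move=> s0 h0; rewrite semigroupD // -(linear_mapB (semigroup_linear s0)).
exact: semigroup_contr.
Qed.

Lemma semigroup_small f e : 0 < e -> exists2 d, 0 < d &
  forall h, 0 <= h -> h < d -> hnorm (V h f - f) <= e.
Proof.
move=> e0; case: sV => _ [_ [_ [_ /(_ f 0 e (lexx _) e0)[d [d0 dP]]]]].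
exists d => // h h0 hd; rewrite -{2}[f]semigroup0 ltW // dP //.
by rewrite subr0 ger0_norm.
Qed.

Lemma left_continuous_semigroup f T : left_continuous (fun s => V s f) T.
Proof.
move=> s s0 sT e /(semigroup_small f)[d d0 dP]; exists d => // h h0 hd hs.
rewrite -{1}[s](subrK h); apply: le_trans (semigroup_incr _ _ _) _.
- by rewrite subr_ge0.
- exact: ltW.
- by rewrite dP // ltW.
Qed.

(** Apply the contraction [V s] to the expansion at [f] and commute it with [V h]. *)
Lemma semigroup_tangent s f g : 0 <= s -> tangent (fun h => V h f - f) g ->
  tangent (fun h => V h (V s f) - V s f) (V s g).
Proof.
move=> s0 D; have lV := semigroup_linear s0.
apply: tangent_ext (tangent_map lV _ D) => [h h0|x]; last exact: semigroup_contr.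
by rewrite /= (linear_mapB lV) -!semigroupD ?(ltW h0) // [s + h]addrC.
Qed.

Lemma semigroup_shift_tangent s f g : 0 <= s -> tangent (fun h => V h f - f) g ->
  tangent (fun h => V (s + h) f - V s f) (V s g).
Proof.
move=> s0 /(semigroup_tangent s0); apply: tangent_ext => h h0.
by rewrite -semigroupD ?(ltW h0) // [s + h]addrC.
Qed.

(** The curve [V r f - f - r%:C *: g] has right derivative [V r g - g], whose norm is at most
    [C]. *)
Lemma semigroup_taylor f g C s : tangent (fun h => V h f - f) g -> 0 <= C ->
  (forall r, 0 <= r -> r < s -> hnorm (V r g - g) <= C) -> 0 <= s ->
  hnorm (V s f - f - s%:C *: g) <= C * s.
Proof.
move=> D C0 CP s0.
apply: (hnorm_growth_le (u := fun r => V r f - f - r%:C *: g) (T := s)) => //.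
- by rewrite semigroup0 scale0r !subrr.
- apply: left_continuousD; first apply: left_continuousD.
  + exact: left_continuous_semigroup.
  + exact: left_continuous_cst.
  + exact/left_continuousN/left_continuous_scale.
move=> r r0 rs e e0; have [d d0 dP] := semigroup_shift_tangent r0 D e0.
exists d => // h h0 hd.
have -> : V (r + h) f - f - (r + h)%:C *: g = (V r f - f - r%:C *: g) +
    ((V (r + h) f - V r f - h%:C *: V r g) + h%:C *: (V r g - g)).
  by vector_ring.
apply: (le_trans (hnormD _ _)); rewrite lerD2l; apply: (le_trans (hnormD _ _)).
rewrite (hnormZr _ (ltW h0)) mulrDl addrC; apply: lerD (dP h h0 hd).
by rewrite mulrC ler_pM2r // CP.
Qed.

(** The threshold [d] depends only on [g] and [e]. At a fixed [s] below it, the Taylor estimate for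
    [u n] has a constant close to [e], and [n] can then be taken large. *)
Lemma tangent_closed (u w : nat -> H) f g :
  (forall n, tangent (fun h => V h (u n) - u n) (w n)) ->
  seq_cvg u f -> seq_cvg w g -> tangent (fun h => V h f - f) g.
Proof.
move=> D uf wg e e0; have [d d0 dP] := semigroup_small g e0.
exists d => // s s0 sd; apply/ler_addgt0Pl => e' e'0.
(* The excess over [e * s] is [2 * del * s] from the Taylor constant, [s * del] from replacing [w n]
   by [g], and [2 * del] from replacing [u n] by [f]. *)
pose k := 3 * s + 2; have k0 : 0 < k by rewrite /k; lra.
have del0 : 0 < e' / k by rewrite divr_gt0.
set del := e' / k in del0.
have [N NP] := uf _ del0; have [M MP] := wg _ del0.
set n := maxn N M.
have {NP} un : hnorm (u n - f) <= del by apply/ltW/NP/leq_maxl.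
have {MP} wn : hnorm (w n - g) <= del by apply/ltW/MP/leq_maxr.
have s0' := ltW s0; have lV := semigroup_linear s0'.
have bnd r : 0 <= r -> r < s -> hnorm (V r (w n) - w n) <= e + 2 * del.
  move=> r0 rs; have lr := semigroup_linear r0.
  have -> : V r (w n) - w n = (V r g - g) + (V r (w n - g) - (w n - g)).
    by rewrite (linear_mapB lr); vector_ring.
  have := hnormD (V r g - g) (V r (w n - g) - (w n - g)).
  have := hnormB (V r (w n - g)) (w n - g).
  have := semigroup_contr (w n - g) r0.
  have := dP r r0 (lt_trans rs sd); lra.
have tay := semigroup_taylor (D n) (ltac:(lra) : 0 <= e + 2 * del) bnd s0'.
have -> : V s f - f - s%:C *: g = (V s (u n) - u n - s%:C *: w n) +
    (s%:C *: (w n - g) - (V s (u n - f) - (u n - f))).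
  by rewrite (linear_mapB lV); vector_ring.
apply: (le_trans (hnormD _ _)).
have := hnormB (s%:C *: (w n - g)) (V s (u n - f) - (u n - f)).
have := hnormB (V s (u n - f)) (u n - f).
have := semigroup_contr (u n - f) s0'.
rewrite (hnormZr _ s0').
have ke : k * del = e' by rewrite /del mulrCA divff ?mulr1 // lt0r_neq0.
by rewrite -ke /k; nra.
Qed.

(** An approximate integral of the orbit of [f] over [0, 1]: on short steps its increments err by at
    most [eta] per unit of time. Validity for every [eta] makes it a genuine primitive. *)
Definition primitive_within (F : R -> H) f (eta : R) := F 0 = 0 /\
  exists2 d, 0 < d & forall s h, 0 <= s -> 0 <= h -> h <= d -> s + h <= 1 ->
    hnorm (F (s + h) - F s - h%:C *: V s f) <= eta * h.

(** Euler polygon with vertices at the multiples of [d], whose slope on each segment is the value of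
    the orbit at the left endpoint. The induction is on the number of segments. *)
Lemma polygonal_primitive f eta : 0 < eta -> exists F, primitive_within F f eta.
Proof.
move=> eta0; have [d' d'0 d'P] := semigroup_small f eta0.
pose d := d' / 2; have d0 : 0 < d by rewrite /d; lra.
have dP h : 0 <= h -> h <= d -> hnorm (V h f - f) <= eta.
  by move=> h0 hd; apply: d'P => //; rewrite /d in hd; lra.
(* That many segments of length [d] cover [0, 1]. *)
suff [F [F0 FP]] : exists F, F 0 = 0 /\ forall s h, 0 <= s -> 0 <= h -> h <= d ->
    s + h <= (Num.trunc d^-1).+1%:R * d ->
    hnorm (F (s + h) - F s - h%:C *: V s f) <= eta * h.
  exists F; split => //; exists d => // s h s0 h0 hd sh; apply: FP => //.
  by apply: (le_trans sh); rewrite -ler_pdivrMr // div1r ltW // truncnS_gt.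
elim: (Num.trunc _).+1 => [|K [F [F0 FP]]].
  exists (fun=> 0); split=> // s h s0 h0 _; rewrite mul0r => sh.
  by have -> : h = 0; [lra|rewrite subrr sub0r scale0r oppr0 hnorm0 mulr0].
set c := K%:R * d in FP.
have c0 : 0 <= c by rewrite mulr_ge0 // ltW.
exists (fun s => if s <= c then F s else F c + (s - c)%:C *: V c f).
split; first by rewrite c0.
move=> s h s0 h0 hd; rewrite -natr1 mulrDl mul1r -/c => sh.
have [sc|cs] := leP s c; have [shc|csh] := leP (s + h) c.
- exact: FP.
(* The step straddles the vertex [c]: the old polygon handles the part of length [k]. On the part of
   length [r] the slope is off by [V c f - V s f], which is small because [k <= d]. *)
- set k := c - s; set r := s + h - c.
  have k0 : 0 <= k by rewrite subr_ge0.
  have r0 : 0 <= r by rewrite subr_ge0 ltW.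
  have skc : s + k = c by rewrite /k; lra.
  have -> : F c + r%:C *: V c f - F s - h%:C *: V s f =
     (F (s + k) - F s - k%:C *: V s f) + r%:C *: (V (s + k) f - V s f).
    by rewrite skc (_ : h = k + r); [vector_ring|rewrite /k /r; ring].
  apply: (le_trans (hnormD _ _)); rewrite (hnormZr _ r0).
  have := FP s k s0 k0; rewrite skc lexx => /(_ _ isT).
  have kd : k <= d by rewrite /k; lra.
  have := le_trans (semigroup_incr f s0 k0) (dP _ k0 kd).
  rewrite skc kd => i1 /(_ isT) i2.
  have -> : eta * h = eta * k + eta * r by rewrite /k /r; ring.
  by apply: lerD => //; rewrite mulrC ler_wpM2r.
- by exfalso; lra.
- set k := s - c.
  have k0 : 0 <= k by rewrite subr_ge0 ltW.
  have ckd : k <= d by rewrite /k; lra.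
  have -> : F c + (s + h - c)%:C *: V c f - (F c + k%:C *: V c f) - h%:C *: V s f
     = - (h%:C *: (V (c + k) f - V c f)).
    by rewrite /k [c + _]subrKC; vector_ring.
  rewrite hnormN (hnormZr _ h0) [leRHS]mulrC ler_wpM2l //.
  exact: le_trans (semigroup_incr f c0 k0) (dP _ k0 ckd).
Qed.

Lemma primitive_within_lip F f eta : 0 < eta -> primitive_within F f eta ->
  exists2 d, 0 < d & forall s h, 0 < h -> h < d -> 0 <= s -> s + h <= 1 ->
    hnorm (F (s + h) - F s) <= (eta + hnorm f) * h.
Proof.
move=> eta0 [_ [d d0 dP]]; exists d => // s h h0 hd s0 sh.
have := dP s h s0 (ltW h0) (ltW hd) sh.
have := hnormD (F (s + h) - F s - h%:C *: V s f) (h%:C *: V s f).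
rewrite subrK (hnormZr _ (ltW h0)) mulrDl.
have := semigroup_contr f s0; rewrite -(ler_pM2l h0); lra.
Qed.

Lemma left_continuous_primitive F f eta : 0 < eta -> primitive_within F f eta ->
  forall s0, 0 <= s0 -> left_continuous (fun r => F (s0 + r)) (1 - s0).
Proof.
move=> eta0 PF s0 s00; have [d d0 dP] := primitive_within_lip eta0 PF.
apply: (left_continuous_lip (C := eta + hnorm f) d0).
  by rewrite ltr_wpDr ?hnorm_ge0.
move=> s h h0 hd s1 sh; rewrite (addrA s0 s h); apply: dP => //; last by lra.
exact: addr_ge0.
Qed.

(** The common slope [V r f] cancels in the difference, leaving a right slope of at most
    [eta + eta']. The growth estimate then removes the restriction to short steps. *)
Lemma primitive_within_dist F G f eta eta' : 0 < eta -> 0 < eta' ->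
  primitive_within F f eta -> primitive_within G f eta' ->
  forall s h, 0 <= s -> 0 <= h -> s + h <= 1 ->
    hnorm ((F (s + h) - G (s + h)) - (F s - G s)) <= (eta + eta') * h.
Proof.
move=> eta0 eta'0 PF PG s h s0 h0 sh.
apply: (hnorm_growth_le (T := 1 - s)
  (u := fun r => (F (s + r) - G (s + r)) - (F s - G s))) => //.
- by rewrite addr_ge0 // ltW.
- by rewrite addr0 subrr.
- apply: left_continuousD; last exact: left_continuous_cst.
  apply: left_continuousD; first exact: left_continuous_primitive PF _ _.
  exact/left_continuousN/(left_continuous_primitive eta'0 PG).
- move=> r r0 r1 e e0; case: PF => _ [d d0 dP]; case: PG => _ [d' d'0 d'P].
  exists (Num.min (Num.min d d') (1 - s - r)); first by rewrite !lt_min d0 d'0; lra.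
  move=> k k0; rewrite !lt_min => /andP[/andP[kd kd'] k1].
  have srk : s + r + k <= 1 by lra.
  have sr := addr_ge0 s0 r0.
  have := dP _ k sr (ltW k0) (ltW kd) srk; have := d'P _ k sr (ltW k0) (ltW kd') srk.
  rewrite -(addrA s r k); set g := V _ f; set x := F _ - _ - _; set y := G _ - _ - _.
  move=> yP xP.
  have -> : F (s + (r + k)) - G (s + (r + k)) - (F s - G s) =
      (F (s + r) - G (s + r) - (F s - G s)) + (x - y).
    by rewrite /x /y; vector_ring.
  apply: (le_trans (hnormD _ _)); rewrite lerD2l.
  apply: (le_trans (hnormB _ _)); rewrite !mulrDl.
  by have := mulr_gt0 e0 k0; lra.
- lra.
Qed.

(** Polygons of accuracy [eta n] form a uniformly Cauchy sequence on [0, 1]. The increments of the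
    limit differ from those of [Fn n] by at most [eta n * h], so the limit inherits every
    accuracy. *)
Lemma exists_primitive f : exists F, forall eta, 0 < eta -> primitive_within F f eta.
Proof.
pose eta n : R := n.+1%:R^-1.
have eta0 n : 0 < eta n by rewrite invr_gt0.
have eta_small e : 0 < e -> exists N, forall n, (N <= n)%N -> eta n <= e.
  move=> e0; exists (Num.trunc e^-1) => n Nn.
  rewrite /eta -[e]invrK lef_pV2 ?posrE ?invr_gt0 //.
  by apply: (le_trans (ltW (truncnS_gt _))); rewrite ler_nat ltnS.
have [Fn FnP] := choice (fun n => polygonal_primitive f (eta0 n)).
have dist0 m n s : 0 <= s -> s <= 1 ->
    hnorm (Fn m s - Fn n s) <= (eta m + eta n) * s.
  move=> s0 s1; have := primitive_within_dist (eta0 m) (eta0 n) (FnP m) (FnP n)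
    (lexx 0) s0; rewrite add0r => /(_ s1).
  by have [-> _] := FnP m; have [-> _] := FnP n; rewrite !subr0.
(* The range conditions sit under the existential so that choice yields a total function; outside
   [0, 1] the value 0 is a placeholder. *)
have lim s : exists l, 0 <= s -> s <= 1 -> seq_cvg (fun n => Fn n s) l.
  have [s0|?] := leP 0 s; last by exists 0; lra.
  have [s1|?] := leP s 1; last by exists 0; lra.
  have [|l lP] := @hilbert_complete _ H (fun n => Fn n s); last by exists l.
  move=> e e0; have [N NP] := eta_small (e / 3) ltac:(lra).
  exists N => m n /NP mP /NP nP; apply: (le_lt_trans (dist0 m n s s0 s1)).
  have := eta0 m; have := eta0 n; nra.
have [F FP] := choice lim.
have F0 : F 0 = 0.
  apply: hnorm_small_eq0 => e e0.
  have [N /(_ N (leqnn N))] := FP 0 (lexx 0) ler01 e e0.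
  by have [-> _] := FnP N; rewrite sub0r hnormN => /ltW.
(* Compare with a third polygon [Fn m] and let [m] grow. *)
have approx n s h : 0 <= s -> 0 <= h -> s + h <= 1 ->
    hnorm ((F (s + h) - Fn n (s + h)) - (F s - Fn n s)) <= eta n * h.
  move=> s0 h0 sh; apply/ler_addgt0Pl => e e0.
  have e30 : 0 < e / 3 by lra.
  have s1 : s <= 1 by lra.
  have [N NP] := eta_small _ e30.
  have [N1 N1P] := FP _ s0 s1 _ e30.
  have [N2 N2P] := FP _ (addr_ge0 s0 h0) sh _ e30.
  pose m := maxn N (maxn N1 N2).
  have := NP m (leq_maxl _ _).
  have := N1P m (leq_trans (leq_maxl _ _) (leq_maxr _ _)).
  have := N2P m (leq_trans (leq_maxr _ _) (leq_maxr _ _)).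
  have := primitive_within_dist (eta0 m) (eta0 n) (FnP m) (FnP n) s0 h0 sh.
  set x := _ - (Fn m s - _); set y := Fn m (s + h) - _; set z := Fn m s - _.
  move=> xP yP zP mP.
  have -> : F (s + h) - Fn n (s + h) - (F s - Fn n s) = x + (z - y).
    by rewrite /x /y /z; vector_ring.
  apply: (le_trans (hnormD _ _)); have := hnormB z y.
  have h1 : h <= 1 by lra.
  rewrite mulrDl in xP; have : eta m * h <= e / 3 by have := eta0 m; nra.
  lra.
exists F => e e0; split=> //.
have e20 : 0 < e / 2 by lra.
have [N /(_ N (leqnn N)) NP] := eta_small _ e20.
have [_ [d d0 dP]] := FnP N; exists d => // s h s0 h0 hd sh.
have := dP s h s0 h0 hd sh; have := approx N s h s0 h0 sh.
set x := _ - (F s - _); set y := _ - h%:C *: _ => xP yP.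
have -> : F (s + h) - F s - h%:C *: V s f = x + y by rewrite /x /y; vector_ring.
apply: (le_trans (hnormD _ _)).
have : eta N * h <= e / 2 * h by rewrite ler_wpM2r.
lra.
Qed.

(** * Exact primitives of orbits lie in the domain of the generator *)

Section Primitive.
Variables (F : R -> H) (f : H).
Hypothesis PF : forall eta, 0 < eta -> primitive_within F f eta.

Let F0 : F 0 = 0. Proof. by case: (PF ltr01). Qed.

Lemma primitive_tangent s : 0 <= s -> s < 1 ->
  tangent (fun h => F (s + h) - F s) (V s f).
Proof.
move=> s0 s1 e e0; have [_ [d d0 dP]] := PF e0.
exists (Num.min d (1 - s)); first by rewrite lt_min d0 subr_gt0.
by move=> h h0; rewrite lt_min => /andP[hd hs]; apply: dP => //; lra.
Qed.

(** As functions of [s] both sides vanish at 0 and have right derivative [V (h + s) f], so the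
    growth estimate with constant 0 applies to their difference. *)
Lemma semigroup_primitive s h : 0 <= s -> 0 <= h -> s + h <= 1 ->
  V h (F s) = F (s + h) - F h.
Proof.
move=> s0 h0 sh; apply/eqP; rewrite -subr_eq0; apply/eqP/hnorm0_eq0/eqP.
rewrite eq_le hnorm_ge0 andbT -(mul0r s).
have lV := semigroup_linear h0.
have lF k : 0 <= k -> left_continuous (fun r => F (k + r)) (1 - k).
  exact: (left_continuous_primitive ltr01 (PF ltr01)).
rewrite [s + h]addrC.
apply: (hnorm_growth_le (T := 1 - h)
  (u := fun r => V h (F r) - (F (h + r) - F h))) => //; last by lra.
- by rewrite F0 (linear_map0 lV) addr0 !subrr.
- apply: left_continuousD.
    apply: left_continuous_map => //; first by move=> x; exact: semigroup_contr.
    have := lF 0 (lexx 0); rewrite subr0 => l0 r r0 r1 e e0.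
    have [d d0 dP] := l0 r r0 ltac:(lra) e e0; exists d => // k k0 kd kr.
    by have := dP k k0 kd kr; rewrite !add0r.
  apply: left_continuousN; apply: left_continuousD; first exact: lF.
  exact: left_continuous_cst.
move=> r r0 rh e e0; have e20 : 0 < e / 2 by lra.
have [d d0 dP] := primitive_tangent r0 (ltac:(lra) : r < 1) e20.
have [d' d'0 d'P] := primitive_tangent (addr_ge0 h0 r0) (ltac:(lra) : h + r < 1) e20.
exists (Num.min d d'); first by rewrite lt_min d0.
move=> k k0; rewrite lt_min => /andP[kd kd'].
have := dP k k0 kd; have := d'P k k0 kd'; rewrite -(addrA h r k) semigroupD //.
set x := _ - _ - _; set y := _ - _ - _ => xP yP.
have -> : V h (F (r + k)) - (F (h + (r + k)) - F h) =
    (V h (F r) - (F (h + r) - F h)) + (V h y - x).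
  by rewrite /x /y !(linear_mapB lV) (linear_mapZ lV); vector_ring.
apply: (le_trans (hnormD _ _)); rewrite lerD2l add0r.
apply: (le_trans (hnormB _ _)); have := semigroup_contr y h0; lra.
Qed.

(** By the shift formula the increment [V h (F s) - F s] is [(F (s + h) - F s) - F h], and the two
    pieces have tangents [V s f] and [f]. *)
Lemma primitive_domain s : 0 <= s -> s < 1 ->
  tangent (fun h => V h (F s) - F s) (V s f - f).
Proof.
move=> s0 s1; have D0 := primitive_tangent (lexx 0) ltr01.
rewrite semigroup0 in D0.
have s10 : 0 < 1 - s by rewrite subr_gt0.
apply: tangent_ext_near s10 _ (tangentB (primitive_tangent s0 s1) D0).
move=> h h0 hs; rewrite semigroup_primitive ?(ltW h0) //; last by lra.
by rewrite add0r F0 subr0 addrAC.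
Qed.

End Primitive.

(** The averages [s^-1%:C *: F s] have a tangent and approach [f] as [s] tends to 0. *)
Lemma tangent_dense f e : 0 < e ->
  exists g, (exists w, tangent (fun h => V h g - g) w) /\ hnorm (f - g) < e.
Proof.
move=> e0; have [F PF] := exists_primitive f.
have e20 : 0 < e / 2 by lra.
have [F0 [d d0 dP]] := PF _ e20.
have m0 : 0 < Num.min d (2^-1) by rewrite lt_min d0 invr_gt0 ltr0n.
have [md m2] : Num.min d (2^-1) <= d /\ Num.min d (2^-1) <= 2^-1.
  by rewrite !ge_min !lexx orbT.
set s := Num.min _ _ in m0 md m2; have s0 := ltW m0.
have s1 : s < 1 by lra.
have := dP 0 s (lexx 0) s0 md; rewrite add0r semigroup0 F0 subr0 => /(_ (ltW s1)) sP.
have siv : s%:C *: (s^-1%:C *: F s) = F s.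
  by rewrite -scaleRM divff ?lt0r_neq0 // scale1r.
exists (s^-1%:C *: F s); split.
  exists (s^-1%:C *: (V s f - f)).
  apply: tangent_ext (tangentZ _ (primitive_domain PF s0 s1)) => h h0.
  by rewrite (linear_mapZ (semigroup_linear (ltW h0))) scalerBr.
rewrite -(ltr_pM2l m0) -(hnormZr _ s0) scalerBr siv hnormC.
by apply: (le_lt_trans sP); rewrite mulrC ltr_pM2l //; lra.
Qed.

End Semigroup.

(** * Uniqueness of a contraction semigroup with given derivative on a dense invariant set *)

Section Uniqueness.
Variables (R : realType) (H : hilbertType R).

(** Algebraic laws and contractivity only; continuity of an orbit is recovered from its tangent at
    0. *)
Definition contractions (V : R -> H -> H) : Prop :=
  [/\ forall s, 0 <= s -> linear_map (V s), forall f, V 0 f = f,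
      forall s r f, 0 <= s -> 0 <= r -> V (s + r) f = V s (V r f) &
      forall s f, 0 <= s -> hnorm (V s f) <= hnorm f].

(** The tangent gives [hnorm (V h f - f) <= (hnorm g + 1) * h] for small [h], and contractivity
    spreads this Lipschitz bound along the orbit. *)
Lemma left_continuous_contractions V f g T : contractions V ->
  tangent (fun h => V h f - f) g -> left_continuous (fun s => V s f) T.
Proof.
move=> [lV _ VD cV] /(_ 1 ltr01)[d d0 dP].
have C0 : 0 < hnorm g + 1 by rewrite ltr_wpDl ?hnorm_ge0.
apply: (left_continuous_lip d0 C0) => s h h0 hd s0 _.
rewrite (VD _ _ _ s0 (ltW h0)) -(linear_mapB (lV s s0)).
apply: (le_trans (cV _ _ s0)); have := hnormD (V h f - f - h%:C *: g) (h%:C *: g).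
by rewrite subrK (hnormZr _ (ltW h0)); have := dP h h0 hd; lra.
Qed.

(* With u r = V r f - W r f one has u (r + h) = V h (u r) + (V h - W h) (W r f),
   and the last term is o(h) since W r f lies in D: |u| cannot grow. *)
Lemma contractions_uniq (V W : R -> H -> H) (D : H -> Prop) :
  contractions V -> contractions W ->
  (forall f e, 0 < e -> exists g, D g /\ hnorm (f - g) < e) ->
  (forall s f, 0 <= s -> D f -> D (W s f)) ->
  (forall f, D f -> exists g, tangent (fun h => V h f - f) g /\
     tangent (fun h => W h f - f) g) ->
  forall s f, 0 <= s -> V s f = W s f.
Proof.
move=> pV pW dense DW DVW s f s0.
have [lV V0 VD cV] := pV; have [lW W0 WD cW] := pW.
have eqD g : D g -> V s g = W s g.
  move=> Dg; have [w [wV wW]] := DVW g Dg.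
  apply/eqP; rewrite -subr_eq0; apply/eqP/hnorm0_eq0/eqP.
  rewrite eq_le hnorm_ge0 andbT -(mul0r s).
  apply: (hnorm_growth_le (T := s) (u := fun r => V r g - W r g)) => //.
  - by rewrite V0 W0 subrr.
  - apply: left_continuousD; first exact: left_continuous_contractions wV.
    by apply: left_continuousN; exact: left_continuous_contractions wW.
  move=> r r0 _ e e0; have [x [xV xW]] := DVW _ (DW r g r0 Dg).
  have [d d0 dP] := tangentB xV xW e0; exists d => // h h0 hd.
  have h0' := ltW h0; have := dP h h0 hd; rewrite subrr scaler0 subr0 add0r.
  rewrite [r + h]addrC (VD _ _ _ h0' r0) (WD _ _ _ h0' r0).
  set y := (V h _ - _ - _) => yP.
  have -> : V h (V r g) - W h (W r g) = V h (V r g - W r g) + y.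
    by rewrite (linear_mapB (lV h h0')) /y; vector_ring.
  by apply: (le_trans (hnormD _ _)); apply: lerD => //; exact: cV.
apply/eqP; rewrite -subr_eq0; apply/eqP/hnorm_small_eq0 => e e0.
have [g [Dg gf]] := dense f (e / 2) ltac:(lra).
have -> : V s f - W s f = V s (f - g) - W s (f - g).
  by rewrite (linear_mapB (lV s s0)) (linear_mapB (lW s s0)) (eqD g Dg); vector_ring.
have := hnormB (V s (f - g)) (W s (f - g)).
have := cV s (f - g) s0; have := cW s (f - g) s0; lra.
Qed.

End Uniqueness.

Section Weyl.
Variables (R : realType) (H : hilbertType R).
Implicit Types (f g : H) (x y : R).

Lemma cexpi0 : cexpi 0 = 1 :> R[i].
Proof. by rewrite /cexpi cos0 sin0. Qed.

Lemma cexpiD x y : cexpi (x + y) = cexpi x * cexpi y.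
Proof. by apply/eqP; rewrite eq_complex /= cosD sinD eqxx addrC [cos x * _]mulrC eqxx. Qed.

Lemma scaleiI f g : 'i *: f = 'i *: g -> f = g.
Proof. exact/scalerI/neq0Ci. Qed.

(** * The generator of a contraction semigroup is linear, densely defined and closed *)

Section Generator.
Variables (A : op H) (V : R -> H -> H).
Hypotheses (sV : contraction_semigroup V) (AV : generated_by A V).

Lemma generator_tangent f : op_dom A f ->
  tangent (fun h => V h f - f) ('i *: op_app A f).
Proof. by move=> Df; apply/right_deriv0P; case: (AV f) => _; exact. Qed.

(** Exhibiting a tangent both proves membership in the domain and, by uniqueness of tangents,
    computes [A]. *)
Lemma tangent_generator f g : tangent (fun h => V h f - f) g ->
  op_dom A f /\ 'i *: op_app A f = g.
Proof.
move=> D; have Df : op_dom A f by apply/(AV f).1; exists g; apply/right_deriv0P.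
by split=> //; exact: tangent_uniq (generator_tangent Df) D.
Qed.

Lemma generator_semigroup s f : 0 <= s -> op_dom A f -> op_dom A (V s f).
Proof.
by move=> s0 /generator_tangent/(semigroup_tangent sV s0)/tangent_generator[].
Qed.

Lemma generator_linear : linear_op A.
Proof.
have lV h : 0 < h -> linear_map (V h) by move/ltW/(semigroup_linear sV).
split.
  suff /tangent_generator[] : tangent (fun h => V h 0 - 0) 0 by [].
  move=> e e0; exists 1 => // h h0 _.
  by rewrite (linear_map0 (lV h h0)) scaler0 !subrr hnorm0 mulr_ge0 // ltW.
move=> c f g /generator_tangent Df /generator_tangent Dg.
have /tangent_generator[? E] : tangent (fun h => V h (c *: f + g) - (c *: f + g))
    (c *: ('i *: op_app A f) + 'i *: op_app A g).
  apply: tangent_ext (tangentD (tangentZ c Df) Dg) => h h0 /=.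
  by rewrite (lV h h0); vector_ring.
by split=> //; apply: scaleiI; rewrite E; vector_ring.
Qed.

Lemma generator_dense : densely_defined A.
Proof.
move=> f e /(tangent_dense sV f)[g [[w /tangent_generator[Dg _]] fg]].
by exists g.
Qed.

Lemma generator_closed : closed_op A.
Proof.
move=> u f g Du uf Aug.
have /tangent_generator[? /scaleiI ?] : tangent (fun h => V h f - f) ('i *: g).
  apply: (tangent_closed sV (w := fun n => 'i *: op_app A (u n))) uf _ => [n|].
    exact: generator_tangent.
  move=> e /Aug[N NP]; exists N => n /NP; by rewrite -scalerBr hnorm_i.
by split.
Qed.

End Generator.

(** * The unitary group and the two implications *)

Section Representation.
Variables (a b : R -> R) (U : R -> H -> H).
Hypotheses (ab : one_param_affine_subgroup a b).
Hypothesis rU : strongly_continuous_unitary_rep a b U.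

Lemma rep_linear t : linear_map (U t).
Proof. by case: rU => /(_ t)[]. Qed.

Lemma rep_inner t f g : inner (U t f) (U t g) = inner f g.
Proof. by case: rU => /(_ t)[_ []]. Qed.

Lemma rep_hnorm t f : hnorm (U t f) = hnorm f.
Proof. by rewrite /hnorm rep_inner. Qed.

Lemma repD t s f : U t (U s f) = U (t + s) f.
Proof. by case: rU => _ [_ [+ _]]; exact. Qed.

(** [U 0] is an idempotent isometry, and it sends [U 0 f - f] to 0. *)
Lemma rep0 f : U 0 f = f.
Proof.
apply/eqP; rewrite -subr_eq0; apply/eqP/hnorm0_eq0.
by rewrite -(rep_hnorm 0) (linear_mapB (rep_linear 0)) repD addr0 subrr hnorm0.
Qed.

Lemma repK t : cancel (U t) (U (- t)).
Proof. by move=> f; rewrite repD addNr rep0. Qed.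

Lemma repVK t : cancel (U (- t)) (U t).
Proof. by move=> f; rewrite repD subrr rep0. Qed.

Lemma rep_adjoint t : is_adjoint (U t) (U (- t)).
Proof. by move=> f g; rewrite -[g in LHS](repVK t) rep_inner. Qed.

(** Invariance quantifies over all adjoints of [U t]; each of them is [U (- t)]. *)
Lemma rep_adjoint_uniq t S g : is_adjoint (U t) S -> S g = U (- t) g.
Proof.
move=> adj; apply: inner_inj => z.
by rewrite inner_conj -adj [RHS]inner_conj rep_adjoint.
Qed.

Lemma rep_tangent t (u : R -> H) g : tangent u g ->
  tangent (fun h => U t (u h)) (U t g).
Proof. by apply: tangent_map => [|x]; [exact: rep_linear|rewrite rep_hnorm]. Qed.

Lemma affine_gt0 t : 0 < a t.
Proof. by case: ab. Qed.

Lemma invariant_weyl A V : G_invariant a b U A -> contraction_semigroup V ->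
  generated_by A V -> weyl_relations a b U V.
Proof.
move=> [_ [denseA [_ invA]]] sV AV t s f s0.
have a0 := affine_gt0 t.
have ge0 r : 0 <= r -> 0 <= a t * r by move=> r0; rewrite mulr_ge0 // ltW.
pose V' r g := U t (V r (U (- t) g)).
pose W r g := cexpi (r * b t) *: V (a t * r) g.
(* At the vector [U t f] the inner [U (- t)] cancels, and the equality of the two semigroups is the
   Weyl relation. *)
suff : V' s (U t f) = W s (U t f) by rewrite /V' repK.
apply: (contractions_uniq (D := op_dom A)) => //.
- split=> [r r0 c x y|x|r q x r0 q0|r x r0]; rewrite /V'.
  + by rewrite rep_linear (semigroup_linear sV r0) rep_linear.
  + by rewrite (semigroup0 sV) repVK.
  + by rewrite repK (semigroupD sV).
  + by rewrite rep_hnorm (le_trans (semigroup_contr sV _ r0)) ?rep_hnorm.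
- split=> [r r0 c x y|x|r q x r0 q0|r x r0]; rewrite /W.
  + by rewrite (semigroup_linear sV (ge0 r r0)); vector_ring.
  + by rewrite mul0r cexpi0 mulr0 scale1r (semigroup0 sV).
  + rewrite (linear_mapZ (semigroup_linear sV (ge0 r r0))) scalerA -cexpiD.
    by rewrite -mulrDl mulrDr (semigroupD sV) ?ge0.
  + by rewrite hnorm_cexpi semigroup_contr ?ge0.
- move=> r x r0 Dx; have [D0 DL] := generator_linear sV AV.
  have := DL (cexpi (r * b t)) _ 0 (generator_semigroup sV AV (ge0 r r0) Dx) D0.
  by rewrite addr0 => -[].
(* The common derivative is ['i] times [a t * A + b t] applied to [x]: the time change and the phase
   give it for [W], invariance gives it for [V']. *)
move=> x Dx; exists ((a t)%:C *: ('i *: op_app A x) + (b t)%:C *: ('i *: x)).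
split; last first.
  apply: (tangent_cexpiM (b t) (u := fun h => V (a t * h) x)).
  exact: (tangent_time (u := fun h => V h x - x)) (generator_tangent AV Dx).
have [_ [_ /(_ _ (rep_adjoint t) x Dx) inv]] := invA t.
have [/(_ x Dx) DU _] := invA (- t).
have -> : (a t)%:C *: ('i *: op_app A x) + (b t)%:C *: ('i *: x) =
    U t ('i *: op_app A (U (- t) x)).
  by rewrite (linear_mapZ (rep_linear t)) inv; vector_ring.
apply: tangent_ext (rep_tangent t (generator_tangent AV DU)) => h h0 /=.
by rewrite (linear_mapB (rep_linear t)) repVK.
Qed.

(** An intertwining form of invariance, free of adjoints: the tangent of the orbit of [U t f] is
    read off from that of [f]. *)
Lemma weyl_generator A V t f : weyl_relations a b U V -> generated_by A V ->
  op_dom A f -> op_dom A (U t f) /\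
  U t (op_app A f) = (a t)%:C *: op_app A (U t f) + (b t)%:C *: U t f.
Proof.
move=> weyl AV Df; have a0 := affine_gt0 t.
have D := rep_tangent t (tangent_time (ltac:(by rewrite invr_gt0) : 0 < (a t)^-1)
  (generator_tangent AV Df)).
have /(tangent_cexpiM (- (b t / a t)) (u := fun h => U t (V ((a t)^-1 * h) f)))
    {}D : tangent (fun h => U t (V ((a t)^-1 * h) f) - U t f)
    (U t ((a t)^-1%:C *: ('i *: op_app A f))).
  by apply: tangent_ext D => h _ /=; rewrite (linear_mapB (rep_linear t)).
have /(tangent_generator AV)[DU E] : tangent (fun h => V h (U t f) - U t f)
    (U t ((a t)^-1%:C *: ('i *: op_app A f)) +
     (- (b t / a t))%:C *: ('i *: U t f)).
  (* The Weyl relation at time [h / a t] produces the phase of [h * b t / a t], which the phase put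
     in front cancels. *)
  apply: tangent_ext D => h h0; rewrite weyl ?mulr_ge0 ?invr_ge0 ?ltW //.
  rewrite scalerA -cexpiD mulrA divff ?lt0r_neq0 // mul1r.
  rewrite (_ : h * - _ + _ = 0) ?cexpi0 ?scale1r //; ring.
split=> //; apply: scaleiI.
have ac : (a t)%:C * (a t)^-1%:C = 1 by rewrite -rmorphM divff ?lt0r_neq0.
have -> : 'i *: ((a t)%:C *: op_app A (U t f) + (b t)%:C *: U t f) =
    (a t)%:C *: ('i *: op_app A (U t f)) + (b t)%:C *: ('i *: U t f).
  by vector_ring.
rewrite E !(linear_mapZ (rep_linear t)) rmorphN rmorphM.
(* Grouping by the product of [a t] and its inverse makes this a polynomial identity; the product is
   replaced by 1 afterwards. *)
have -> : (a t)%:C *: ((a t)^-1%:C *: ('i *: U t (op_app A f)) +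
    - ((b t)%:C * (a t)^-1%:C) *: ('i *: U t f)) + (b t)%:C *: ('i *: U t f) =
    ((a t)%:C * (a t)^-1%:C) *: ('i *: U t (op_app A f)) +
    (1 - (a t)%:C * (a t)^-1%:C) *: ((b t)%:C *: ('i *: U t f)) by vector_ring.
by rewrite ac subrr scale0r addr0 scale1r.
Qed.

Lemma weyl_invariant A V : contraction_semigroup V -> weyl_relations a b U V ->
  generated_by A V -> G_invariant a b U A.
Proof.
move=> sV weyl AV; split; first exact: generator_linear sV AV.
split; first exact: generator_dense sV AV.
split; first exact: generator_closed sV AV.
have DU t f : op_dom A f -> op_dom A (U t f) by case/(weyl_generator t weyl AV).
move=> t; split; first exact: DU.
split=> [f Df|S adj f Df].
  by exists (U (- t) f); split; [exact: DU|exact: repVK].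
rewrite (rep_adjoint_uniq _ adj).
(* The intertwining relation is used at [U (- t) f], which [U t] sends back to [f]. *)
by have [_ ->] := weyl_generator t weyl AV (DU (- t) f Df); rewrite repVK.
Qed.

End Representation.

End Weyl.

Theorem theorem2p6 (R : realType) (H : hilbertType R) (a b : R -> R)
    (U : R -> H -> H) :
  one_param_affine_subgroup a b ->
  strongly_continuous_unitary_rep a b U ->
  (forall A : op H, max_dissipative A -> G_invariant a b U A ->
     forall V : R -> H -> H, contraction_semigroup V -> generated_by A V ->
       weyl_relations a b U V) /\
  (forall V : R -> H -> H, contraction_semigroup V -> weyl_relations a b U V ->
     forall A : op H, generated_by A V -> G_invariant a b U A).
Proof.
move=> ab rU; split=> [A _ invA V sV AV|V sV weyl A AV].
- exact: invariant_weyl ab rU _ _ invA sV AV.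
- exact: weyl_invariant ab rU _ _ sV weyl AV.
Qed.
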